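(* Let $A$ be an abelian group, and let $\mu:\mathbb{Z}_3\to\mathbb{Z}$ and $\tau:\mathbb{Z}_3\to A$ be functions such that $\mu(0)=2$, $\mu(1)=\mu(2)=-1$, and $\tau(0)=0$. Then the binary operation on $\mathbb{Z}_3\times A$ defined by $$(x,a)*(y,b)=\bigl(2y-x,\,-a+\mu(x-y)b+\tau(x-y)\bigr),\qquad x,y\in\mathbb{Z}_3,\ a,b\in A,$$ makes $\mathbb{Z}_3\times A$ a quandle.
   Context: $\mathbb{Z}_n$ denotes the integers modulo $n$; an abelian group $A$ is regarded as a $\mathbb{Z}$-module. A quandle is a non-empty set $X$ with a binary operation $*$ such that: (1) $a*a=a$ for all $a\in X$; (2) for all $b,c\in X$ there is a unique $a\in X$ with $a*b=c$; (3) $(a*b)*c=(a*c)*(b*c)$ for all $a,b,c\in X$. *)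

(* Defs.v *)
From mathcomp Require Import all_boot all_order all_algebra.

Set Implicit Arguments.
Unset Strict Implicit.
Unset Printing Implicit Defensive.

Import GRing.Theory.
Local Open Scope ring_scope.

Record is_quandle (X : Type) (op : X -> X -> X) : Prop := IsQuandle {
  quandle_nonempty : inhabited X;
  quandle_idempotent : forall a, op a a = a;
  quandle_right_divisible : forall b c, exists! a, op a b = c;
  quandle_right_distributive :
    forall a b c, op (op a b) c = op (op a c) (op b c) }.

(* [b *~ k] is the action of the integer [k] on the Z-module [A]. *)
Definition galkin_op (A : zmodType) (mu : 'Z_3 -> int) (tau : 'Z_3 -> A)
    (p q : 'Z_3 * A) : 'Z_3 * A :=
  let: (x, a) := p in
  let: (y, b) := q in
  (2 * y - x, - a + b *~ mu (x - y) + tau (x - y)).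

(* Main.v *)
Require Import Defs.
From mathcomp Require Import all_boot all_order all_algebra.
From mathcomp Require Import ring.

Import GRing.Theory.
Local Open Scope ring_scope.

(** The first coordinate of the operation is the dihedral quandle of Z_3, and
    in the second one the map sending [a] to the product [(x, a) * (y, b)] is a
    negation followed by a translation, so it is invertible.  Idempotence is
    the pair of normalizations [mu 0 = 2] and [tau 0 = 0].

    The content is in distributivity.  Put [d = x - y] and [e = y - z], so that
    [x - z = e + d] and [(2y - x) - z = e - d].  Comparing the coefficients of
    [b] and [c] and the constant terms in the second coordinate leaves
      [mu (- d) = mu d],
      [mu (e + d) + mu (e - d) = mu d * mu e],
      [tau (e + d) + tau (e - d) = mu d * tau e + tau d + tau (- d)].
    The second is d'Alembert's functional equation, which holds because
    [mu d = 2 cos (2 pi d / 3)].  Both of the last two identities are trivial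
    for [d = 0], where [mu d = 2].  For [d != 0] one has [mu d = -1], and
    moving [mu d] times the value at [e] to the left produces the sum of the
    function over [e, e + d, e - d], that is, over all of Z_3; this sum does
    not depend on [e] ([sum_translate_Z3]).  It is 0 for [mu], and
    [tau d + tau (- d)] for [tau] because [tau 0 = 0]. *)

(** For nonzero [d], translating by [e] permutes the three elements
    [0], [d], [- d] of Z_3. *)
Lemma sum_translate_Z3 (V : nmodType) (f : 'Z_3 -> V) (d e : 'Z_3) :
  d != 0 -> f e + f (e + d) + f (e - d) = f 0 + f d + f (- d).
Proof.
move=> d_neq0.
have : [|| e == 0, e == d | e == - d].
  by case: d e d_neq0 => [[|[|[|?]]] ?] [[|[|[|?]]] ?].
case/or3P => /eqP ->.
- by rewrite !add0r.
- have -> : d + d = - d by apply/eqP; case: d {d_neq0} => [[|[|[|?]]] ?].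
  by rewrite subrr addrC addrA.
- have -> : - d - d = d by apply/eqP; case: d {d_neq0} => [[|[|[|?]]] ?].
  by rewrite addNr -addrA addrC.
Qed.

Section Coefficients.

Variables (A : zmodType) (mu : 'Z_3 -> int) (tau : 'Z_3 -> A).
Hypotheses (mu0 : mu 0 = 2) (mu1 : mu 1 = -1) (mu2 : mu 2 = -1).
Hypothesis tau0 : tau 0 = 0.

Lemma mu_neq0 (d : 'Z_3) : d != 0 -> mu d = -1.
Proof.
have Z3E : [|| d == 0, d == 1 | d == 2] by case: d => [[|[|[|?]]] ?].
by case/or3P: Z3E => /eqP ->.
Qed.

Lemma mu_opp (d : 'Z_3) : mu (- d) = mu d.
Proof.
have [->|d_neq0] := eqVneq d 0; first by rewrite oppr0.
by rewrite !mu_neq0 ?oppr_eq0.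
Qed.

(** Multiplicativity in disguise: [mu d] is the trace of the rotation of order 3
    raised to the power [d], hence d'Alembert's equation for cosines. *)
Lemma mu_dAlembert (d e : 'Z_3) : mu (e + d) + mu (e - d) = mu e * mu d.
Proof.
have [->|d_neq0] := eqVneq d 0; first by rewrite subr0 addr0 mu0 mulr_natr.
have := sum_translate_Z3 _ mu d e d_neq0.
rewrite mu_opp mu0 (mu_neq0 _ d_neq0) mulrN1 => sumE.
by apply/eqP; rewrite -addr_eq0 addrC addrA sumE.
Qed.

(** The values of [tau] away from 0 are arbitrary: only the sum of [tau] over
    Z_3 enters, which is why a quandle results for every such [tau]. *)
Lemma tau_dAlembert (d e : 'Z_3) :
  tau (e + d) + tau (e - d) = tau e *~ mu d + (tau d + tau (- d)).
Proof.
have [->|d_neq0] := eqVneq d 0.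
  by rewrite subr0 addr0 oppr0 tau0 !addr0 mu0.
have := sum_translate_Z3 _ tau d e d_neq0.
by rewrite (mu_neq0 _ d_neq0) tau0 add0r => <-; rewrite mulrN1z -addrA addKr.
Qed.

Lemma galkin_op_idempotent p : galkin_op mu tau p p = p.
Proof.
case: p => x a /=; rewrite subrr mu0 tau0 addr0; congr pair.
  by rewrite mulr_natl mulr2n addrK.
by rewrite addKr.
Qed.

Lemma galkin_op_divisible q r : exists! p, galkin_op mu tau p q = r.
Proof.
case: q r => [y b] [z c] /=; set x := 2 * y - z.
exists (x, b *~ mu (x - y) + tau (x - y) - c); split=> [|[x' a] /= [zE cE]].
  by congr pair; [rewrite subKr | rewrite opprB -addrA subrK].
have -> : x = x' by rewrite /x -zE subKr.
by rewrite -cE -[- a + _ + _]addrA [- a + _]addrC subKr.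
Qed.

Lemma galkin_op_distributive p q r :
  galkin_op mu tau (galkin_op mu tau p q) r =
  galkin_op mu tau (galkin_op mu tau p r) (galkin_op mu tau q r).
Proof.
case: p q r => [x a] [y b] [z c] /=.
set d := x - y; set e := y - z.
have -> : x - z = e + d by rewrite /d /e; ring.
have -> : 2 * y - x - z = e - d by rewrite /d /e; ring.
have -> : 2 * z - x - (2 * z - y) = - d by rewrite /d; ring.
rewrite mu_opp; congr pair; first by ring.
clearbody d e.
(* Eliminating the values at [e - d], which occur only on the left, makes both
   sides sums of the same terms, up to the cancelling pair [- tau d], [tau d]. *)
have -> : mu (e - d) = mu e * mu d - mu (e + d).
  by rewrite -mu_dAlembert addrAC subrr add0r.
have -> : tau (e - d) = tau e *~ mu d + (tau d + tau (- d)) - tau (e + d).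
  by rewrite -tau_dAlembert addrAC subrr add0r.
rewrite mulrzBr mulrzA !mulrzDl mulNrz !opprD !opprK !addrA.
rewrite [LHS](ACl ((1*5*9*2*4*6*8)*(3*7)))%AC /=.
by rewrite addNr addr0.
Qed.

End Coefficients.

Theorem proposition3p1 (A : zmodType) (mu : 'Z_3 -> int) (tau : 'Z_3 -> A)
    (mu0 : mu 0 = 2) (mu1 : mu 1 = -1) (mu2 : mu 2 = -1) (tau0 : tau 0 = 0) :
  is_quandle (galkin_op mu tau).
Proof.
split.
- exact: (inhabits (0, 0)).
- exact: galkin_op_idempotent.
- exact: galkin_op_divisible.
- exact: galkin_op_distributive.
Qed.
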